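(* Let $X$ be a uniformly convex and uniformly smooth (real or complex) Banach space. Then, given $\varepsilon>0$, there exists $\eta(\varepsilon)>0$ such that whenever $T_0\in\mathcal{L}(X)$ with $v(T_0)=1$ and $(x_0,x_0^* )\in\Pi(X)$ satisfy $|x_0^*(T_0x_0)|>1-\eta(\varepsilon)$, there exist $S\in\mathcal{L}(X)$ and $(y,y^* )\in\Pi(X)$ such that $$v(S)=|y^*(Sy)|,\quad \|x_0-y\|<\varepsilon,\quad \|x_0^*-y^*\|<\varepsilon\quad\text{and}\quad \|S-T_0\|<\varepsilon.$$
   Context: For a real or complex Banach space $X$ with dual $X^*$ and unit sphere $S_X$, $\mathcal{L}(X)$ is the space of bounded linear operators on $X$ with the operator norm, $\Pi(X)=\{(x,x^* )\in S_X\times S_{X^*} : x^*(x)=1\}$, and the numerical radius of $T\in\mathcal{L}(X)$ is $v(T)=\sup\{|x^*(Tx)| : (x,x^* )\in\Pi(X)\}$. *)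

(* Defs.v *)
From Stdlib Require Export Reals.
From Coquelicot Require Export Coquelicot.
Open Scope R_scope.

(* [is_linear] of Coquelicot means linear and bounded. The set below is nonempty,
   and it is bounded above when [f] is bounded, so the least upper bound is then
   a genuine real number. *)
Definition op_norm {K : AbsRing} {U V : NormedModule K} (f : U -> V) : R :=
  real (Lub_Rbar (fun r => exists x : U, norm x <= 1 /\ r = norm (f x))).

(* The scalar field as a normed space over itself, with norm [abs]. *)
Notation scalars K := (AbsRing_NormedModule K).

Definition states {K : AbsRing} {X : NormedModule K}
    (x : X) (xs : X -> scalars K) : Prop :=
  norm x = 1 /\ is_linear xs /\ op_norm xs = 1 /\ xs x = one.

Definition num_radius {K : AbsRing} {X : NormedModule K} (T : X -> X) : R :=
  real (Lub_Rbar (fun r => exists (x : X) (xs : X -> scalars K),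
    states x xs /\ r = norm (xs (T x)))).

Definition uniformly_convex {K : AbsRing} (X : NormedModule K) : Prop :=
  forall eps : R, 0 < eps -> exists delta : R, 0 < delta /\
    forall x y : X, norm x = 1 -> norm y = 1 -> eps <= norm (minus x y) ->
      norm (plus x y) / 2 <= 1 - delta.

(* The supremum is over a bounded set, every term lying in [0, t]. *)
Definition smoothness_modulus {K : AbsRing} (X : NormedModule K) (t : R) : R :=
  real (Lub_Rbar (fun r => exists x y : X, norm x = 1 /\ norm y = t /\
    r = (norm (plus x y) + norm (minus x y)) / 2 - 1)).

Definition uniformly_smooth {K : AbsRing} (X : NormedModule K) : Prop :=
  filterlim (fun t : R => smoothness_modulus X t / t) (at_right 0) (locally 0).

(* Main.v *)
Require Import Defs.
From Stdlib Require Import IndefiniteDescription Classical Lra Lia.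

(** Write [v(T)] for the numerical radius and call [(x, x* )] a state when
    [|x| = |x*| = 1] and [x*(x) = 1].

    The proof repairs [T0] by infinitely many rank-one perturbations of
    geometrically decreasing size.  Suppose [|x*(T x)| > v(T) - h].  Put
    [T' z = T z + x*(z) c x] with [|c| = r] and the phase of [c] chosen so that
    [|x*(T' x)| = |x*(T x)| + r].  Take a state [(y, y* )] that attains [v(T')]
    up to [h'].  Evaluating [T'] at it gives
    [|x*(T x)| + r - h' <= |y*(T' y)| <= |x*(T x)| + h + r |x*(y)| |y*(x)|],
    hence [|x*(y)| >= 1 - (h + h')/r].  Rotating [y] and [y*] in opposite
    directions makes [x*(y)] a nonnegative real.  Uniform convexity then forces [y] to be close
    to [x], and uniform smoothness forces [y*] to be close to [x*]
    ([states_close]), while [|T' - T| <= r].  How small [h + h'] has to be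
    depends on [r] and on [X] alone; this is [rank_one_step].  It must not
    depend on [|T|], because [v(T0) = 1] does not bound [|T0|] over the reals.

    Iterating with [r_n = r / 2^n] and errors [h_n] that tend to [0] fast enough,
    the operators, the points and the functionals all converge, and the limit
    state attains the numerical radius of the limit operator
    ([limit_nearly_attains]).  The total displacement is at most [2 r].

    Both scalar fields are treated at once through the class [RealOrComplex],
    which lists the few facts about them that the argument uses. *)

(** * The scalar field *)

(** What the real and the complex field have in common.  Limits of scalars are
    not provided here: they are taken inside the Banach space, in
    [geometric_limit_functional].  [phase] returns the inverse [v] of the
    unimodular [u] as well, because an [AbsRing] has no inversion. *)
Class RealOrComplex (K : AbsRing) := {
  of_R : R -> K;
  re : K -> R;
  of_R_plus : forall r s, of_R (r + s) = plus (of_R r) (of_R s);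
  of_R_mult : forall r s, of_R (r * s) = mult (of_R r) (of_R s);
  of_R_1 : of_R 1 = one;
  abs_of_R : forall r, abs (of_R r) = Rabs r;
  re_plus : forall a b, re (plus a b) = re a + re b;
  re_of_R : forall r, re (of_R r) = r;
  re_le_abs : forall a, re a <= abs a;
  phase : forall a : K, exists u v : K,
    mult u v = one /\ mult v u = one /\ abs u = 1 /\ abs v = 1 /\
    mult u a = of_R (abs a)
}.

#[local] Instance R_scalars : RealOrComplex R_AbsRing.
Proof.
  refine (Build_RealOrComplex R_AbsRing (fun r => r) (fun r => r)
            _ _ _ _ _ _ _ _); try reflexivity.
  - intros a. apply Rle_abs.
  - intros a. change R in a.
    destruct (Rle_lt_dec 0 a) as [h | h].
    + exists 1, 1.
      repeat split; try apply Rmult_1_l; try apply Rabs_R1.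
      change (1 * a = Rabs a). rewrite Rabs_pos_eq; lra.
    + exists (-1), (-1).
      assert (Rabs (-1) = 1) by (rewrite Rabs_left; lra).
      repeat split; try assumption; try (change ((-1) * (-1) = 1); ring).
      change (-1 * a = Rabs a). rewrite Rabs_left; lra.
Defined.

#[local] Instance C_scalars : RealOrComplex C_AbsRing.
Proof.
  refine (Build_RealOrComplex C_AbsRing RtoC Re _ _ _ _ _ _ _ _).
  - exact RtoC_plus.
  - exact RtoC_mult.
  - reflexivity.
  - exact Cmod_R.
  - reflexivity.
  - reflexivity.
  - intros a. apply Rle_trans with (2 := re_le_Cmod a). apply Rle_abs.
  - intros a. change C in a.
    destruct (classic (a = 0%C)) as [-> | h].
    + exists (RtoC 1), (RtoC 1).
      change ((1 * 1)%C = 1%C /\ (1 * 1)%C = 1%C /\ Cmod 1 = 1 /\ Cmod 1 = 1 /\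
              (1 * 0)%C = RtoC (Cmod 0)).
      rewrite Cmod_1, Cmod_0. repeat split; ring.
    + assert (hp := proj1 (Cmod_gt_0 a) h).
      assert (hn : RtoC (Cmod a) <> 0%C) by (intros e; apply RtoC_inj in e; lra).
      exists (RtoC (Cmod a) / a)%C, (a / RtoC (Cmod a))%C.
      change ((RtoC (Cmod a) / a * (a / RtoC (Cmod a)))%C = 1%C /\
              (a / RtoC (Cmod a) * (RtoC (Cmod a) / a))%C = 1%C /\
              Cmod (RtoC (Cmod a) / a) = 1 /\ Cmod (a / RtoC (Cmod a)) = 1 /\
              (RtoC (Cmod a) / a * a)%C = RtoC (Cmod a)).
      rewrite !Cmod_div, !Cmod_R, Rabs_pos_eq by (assumption || lra).
      repeat split; field; auto; lra.
Defined.

Section Scalars.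
Context {K : AbsRing} {F : RealOrComplex K}.

Lemma re_opp (a : K) : re (opp a) = - re a.
Proof.
  assert (h0 : re (zero : K) = 0).
  { generalize (re_plus zero (zero : K)). rewrite plus_zero_l. lra. }
  generalize (re_plus a (opp a)).
  replace (plus a (opp a)) with (zero : K) by (symmetry; exact (plus_opp_r a)).
  lra.
Qed.

Lemma re_minus (a b : K) : re (minus a b) = re a - re b.
Proof.
  unfold minus. transitivity (re a + re (opp b)); [exact (re_plus a (opp b)) |].
  rewrite re_opp. ring.
Qed.

Lemma re_one : re (one : K) = 1.
Proof. rewrite <- of_R_1. apply re_of_R. Qed.

(** In an [AbsRing] the absolute value is only submultiplicative, so equality is
    obtained by undoing the two unimodular factors. *)
Lemma abs_unit_conj (u v a : K) :
  mult u v = one -> mult v u = one -> abs u = 1 -> abs v = 1 ->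
  abs (mult (mult u a) v) = abs a.
Proof.
  intros huv hvu hu hv.
  assert (h : forall p q b : K, abs p = 1 -> abs q = 1 ->
                abs (mult (mult p b) q) <= abs b).
  { intros p q b hp hq. eapply Rle_trans; [apply abs_mult |].
    rewrite hq, Rmult_1_r. eapply Rle_trans; [apply abs_mult |].
    rewrite hp. lra. }
  apply Rle_antisym; [now apply h |].
  assert (e : a = mult (mult v (mult (mult u a) v)) u).
  { rewrite !mult_assoc, hvu, mult_one_l, <- mult_assoc, hvu, mult_one_r.
    reflexivity. }
  rewrite e at 1. now apply h.
Qed.

(** The choice of [c] in the rank-one perturbation: [c] has the phase of [a], so
    that adding it increases the modulus as much as possible. *)
Lemma aligned_scalar (a : K) (r : R) :
  0 <= r -> exists c : K, abs c <= r /\ abs (plus a c) = abs a + r.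
Proof.
  intros hr. destruct (phase a) as (u & v & huv & hvu & hu & hv & hua).
  exists (mult v (of_R r)).
  assert (hc : abs (mult v (of_R r)) <= r).
  { eapply Rle_trans; [apply abs_mult |].
    rewrite hv, abs_of_R, Rabs_pos_eq; lra. }
  split; [exact hc |].
  apply Rle_antisym.
  - eapply Rle_trans; [apply abs_triangle | lra].
  - assert (e : mult u (plus a (mult v (of_R r))) = of_R (abs a + r)).
    { rewrite of_R_plus, <- hua.
      transitivity (plus (mult u a) (mult u (mult v (of_R r)))).
      - exact (mult_distr_l u a (mult v (of_R r))).
      - now rewrite (mult_assoc u v), huv, mult_one_l. }
    assert (ha := abs_ge_0 a).
    rewrite <- (Rabs_pos_eq (abs a + r)) by lra.
    rewrite <- (abs_of_R (abs a + r)), <- e.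
    eapply Rle_trans; [apply abs_mult |]. rewrite hu. lra.
Qed.

Context {V : NormedModule K}.

Lemma norm_scal_of_R (r : R) (x : V) :
  0 < r -> norm (scal (of_R r) x) = r * norm x.
Proof.
  intros hr.
  assert (h : forall s (y : V), 0 < s -> norm (scal (of_R s) y) <= s * norm y).
  { intros s y hs. eapply Rle_trans; [apply norm_scal |].
    rewrite abs_of_R, Rabs_pos_eq; lra. }
  apply Rle_antisym; [now apply h |].
  assert (e : x = scal (of_R (/ r)) (scal (of_R r) x)).
  { rewrite scal_assoc, <- of_R_mult, Rinv_l, of_R_1, scal_one by lra.
    reflexivity. }
  rewrite e at 1.
  apply Rle_trans with (r * (/ r * norm (scal (of_R r) x))).
  - apply Rmult_le_compat_l; [lra |]. apply h. now apply Rinv_0_lt_compat.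
  - right. field. lra.
Qed.

Lemma norm_scal_unit (u v : K) (x : V) :
  mult v u = one -> abs u = 1 -> abs v = 1 -> norm (scal u x) = norm x.
Proof.
  intros hvu hu hv. apply Rle_antisym.
  - eapply Rle_trans; [apply norm_scal |]. rewrite hu. lra.
  - rewrite <- (scal_one x) at 1. rewrite <- hvu, <- scal_assoc.
    eapply Rle_trans; [apply norm_scal |]. rewrite hv. lra.
Qed.
End Scalars.

(** * Suprema and operator norms *)

Section Suprema.
Implicit Type E : R -> Prop.

(** The projection [real] sends infinite bounds to [0], so every use of it below
    needs a nonempty bounded set. *)
Lemma Lub_finite E M r :
  (forall s, E s -> s <= M) -> E r -> Finite (real (Lub_Rbar E)) = Lub_Rbar E.
Proof.
  intros hM hr. destruct (Lub_Rbar_correct E) as [h1 h2].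
  assert (a := h1 _ hr).
  assert (b := h2 (Finite M) (fun s hs => hM s hs)).
  destruct (Lub_Rbar E); simpl in *; tauto.
Qed.

Lemma le_real_Lub E M r :
  (forall s, E s -> s <= M) -> E r -> r <= real (Lub_Rbar E).
Proof.
  intros hM hr. destruct (Lub_Rbar_correct E) as [h1 _].
  specialize (h1 _ hr). rewrite <- (Lub_finite E M r hM hr) in h1. exact h1.
Qed.

Lemma real_Lub_le E M r :
  (forall s, E s -> s <= M) -> E r -> real (Lub_Rbar E) <= M.
Proof.
  intros hM hr. destruct (Lub_Rbar_correct E) as [_ h2].
  specialize (h2 (Finite M) (fun s hs => hM s hs)).
  rewrite <- (Lub_finite E M r hM hr) in h2. exact h2.
Qed.

Lemma real_Lub_approx E M r e :
  (forall s, E s -> s <= M) -> E r -> 0 < e ->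
  exists s, E s /\ forall t, E t -> t <= s + e.
Proof.
  intros hM hr he. apply NNPP. intros hn.
  assert (h : real (Lub_Rbar E) <= real (Lub_Rbar E) - e).
  { apply real_Lub_le with r; [| exact hr].
    intros s hs. apply Rnot_lt_le. intros hlt. apply hn.
    exists s. split; [exact hs |]. intros t ht.
    assert (h := le_real_Lub E M t hM ht). lra. }
  lra.
Qed.
End Suprema.

Lemma minus_plus_plus {G : AbelianGroup} (a b c d : G) :
  minus (plus a b) (plus c d) = plus (minus a c) (minus b d).
Proof.
  unfold minus. rewrite opp_plus, <- !plus_assoc. f_equal.
  rewrite !plus_assoc. f_equal. apply plus_comm.
Qed.

Lemma minus_zero_eq {G : AbelianGroup} (x y : G) : minus x y = zero -> x = y.
Proof.
  intros h. apply plus_reg_r with (opp y). rewrite plus_opp_r. exact h.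
Qed.

Section Norms.
Context {K : AbsRing} {V : NormedModule K}.

Lemma norm_minus_sym (x y : V) : norm (minus x y) = norm (minus y x).
Proof. rewrite <- (norm_opp (minus x y)), opp_minus. reflexivity. Qed.

Lemma norm_minus_self (x : V) : norm (minus x x) = 0.
Proof.
  transitivity (norm (zero : V)); [| apply norm_zero].
  f_equal. exact (minus_eq_zero x).
Qed.

Lemma norm_minus_le (x y : V) : norm (minus x y) <= norm x + norm y.
Proof. rewrite <- (norm_opp y). exact (norm_triangle x (opp y)). Qed.

Lemma norm_minus_triangle (x y z : V) :
  norm (minus x z) <= norm (minus x y) + norm (minus y z).
Proof. rewrite (minus_trans y). apply norm_triangle. Qed.

Lemma norm_le_minus_plus (x y : V) : norm x <= norm (minus x y) + norm y.
Proof. assert (h := norm_triangle_inv x y). apply Rabs_le_between in h. lra. Qed.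

Lemma norm_minus_plus (a b c d : V) :
  norm (minus (plus a b) (plus c d)) <= norm (minus a c) + norm (minus b d).
Proof.
  replace (minus (plus a b) (plus c d)) with (plus (minus a c) (minus b d))
    by (symmetry; exact (minus_plus_plus a b c d)).
  apply norm_triangle.
Qed.
End Norms.

Section Linear.
Context {K : AbsRing} {U V : NormedModule K}.

Lemma linear_minus (f : U -> V) (x y : U) :
  is_linear f -> f (minus x y) = minus (f x) (f y).
Proof.
  intros hf. unfold minus. rewrite (linear_plus f hf). f_equal.
  transitivity (f (scal (opp one) y)).
  - f_equal. symmetry. exact (scal_opp_one y).
  - rewrite (linear_scal f hf). exact (scal_opp_one (f y)).
Qed.

Lemma is_linear_add (f g : U -> V) :
  is_linear f -> is_linear g -> is_linear (fun x => plus (f x) (g x)).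
Proof.
  intros hf hg.
  apply (is_linear_comp (fun x => (f x, g x)) (fun t : V * V => plus (fst t) (snd t))).
  - now apply is_linear_prod.
  - apply is_linear_plus.
Qed.

Lemma is_linear_rank_one (f : U -> scalars K) (v : V) :
  is_linear f -> is_linear (fun z => scal (f z) v).
Proof.
  intros hf. exact (is_linear_comp f (fun k : scalars K => scal k v) hf
    (is_linear_scal_l v)).
Qed.

Lemma op_norm_le (f : U -> V) (M : R) :
  0 <= M -> (forall x, norm (f x) <= M * norm x) -> op_norm f <= M.
Proof.
  intros hM hf. unfold op_norm.
  apply real_Lub_le with (norm (f zero)).
  - intros s (x & hx & ->). eapply Rle_trans; [apply hf |]. nra.
  - exists zero. rewrite norm_zero. split; [lra | reflexivity].
Qed.

Lemma le_op_norm (f : U -> V) (x : U) :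
  is_linear f -> norm x <= 1 -> norm (f x) <= op_norm f.
Proof.
  intros hf hx. destruct (linear_norm f hf) as (M & hM & hb).
  unfold op_norm. apply le_real_Lub with M.
  - intros s (y & hy & ->). eapply Rle_trans; [apply hb |]. nra.
  - now exists x.
Qed.

Lemma norm_le_op_norm {F : RealOrComplex K} (f : U -> V) (x : U) :
  is_linear f -> norm (f x) <= op_norm f * norm x.
Proof.
  intros hf. destruct (Rle_lt_or_eq_dec 0 (norm x) (norm_ge_0 x)) as [h | h].
  - assert (hi := Rinv_0_lt_compat _ h).
    assert (e := norm_scal_of_R _ x hi).
    rewrite Rinv_l in e by lra.
    assert (b := le_op_norm f (scal (of_R (/ norm x)) x) hf (Req_le _ _ e)).
    rewrite (linear_scal f hf), norm_scal_of_R in b by exact hi.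
    apply Rmult_le_compat_r with (r := norm x) in b; [| lra].
    field_simplify in b; lra.
  - destruct (linear_norm f hf) as (M & hM & hb). specialize (hb x).
    rewrite <- h in *. lra.
Qed.
End Linear.

(** * States of a uniformly convex and uniformly smooth space *)

Section States.
Context {K : AbsRing} {F : RealOrComplex K} {X : NormedModule K}.
Implicit Types (x y z : X) (xs ys zs : X -> scalars K).

(** The form in which states are used: the pointwise bound replaces the
    supremum in the operator norm. *)
Lemma states_iff x xs :
  states x xs <-> norm x = 1 /\ is_linear xs /\
    (forall z, norm (xs z) <= norm z) /\ xs x = one.
Proof.
  split.
  - intros (hx & hl & ho & h1). repeat split; try assumption; try apply hl.
    intros z. assert (h := norm_le_op_norm xs z hl). rewrite ho in h. lra.
  - intros (hx & hl & ho & h1). repeat split; try assumption; try apply hl.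
    apply Rle_antisym.
    + apply op_norm_le; [lra |]. intros z. specialize (ho z). lra.
    + assert (h := le_op_norm xs x hl (Req_le _ _ hx)).
      rewrite h1 in h. change (abs (one : K) <= op_norm xs) in h.
      rewrite abs_one in h. exact h.
Qed.

Lemma is_linear_mult_r (f : X -> scalars K) (c : K) :
  is_linear f -> is_linear (fun z => mult (f z) c : scalars K).
Proof.
  intros hf. exact (is_linear_comp f (fun k : scalars K => scal k (c : scalars K)) hf
    (is_linear_scal_l (c : scalars K))).
Qed.

(** Rotating a point and a functional in opposite directions keeps the pairing
    equal to [1], and by [abs_rotate] it does not change the value that the
    numerical radius looks at. *)
Lemma states_rotate x xs (u v : K) :
  mult u v = one -> mult v u = one -> abs u = 1 -> abs v = 1 ->
  states x xs -> states (scal u x) (fun z => mult (xs z) v).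
Proof.
  intros huv hvu hu hv. rewrite !states_iff. intros (hx & hl & ho & h1).
  repeat split; try apply (is_linear_mult_r xs v hl).
  - rewrite (norm_scal_unit u v) by assumption. exact hx.
  - intros z. eapply Rle_trans; [exact (abs_mult (xs z) v) |].
    rewrite hv, Rmult_1_r. apply ho.
  - rewrite (linear_scal xs hl), h1. change (mult (mult u one) v = (one : K)).
    now rewrite mult_one_r.
Qed.

Lemma abs_rotate x xs (T : X -> X) (u v : K) :
  mult u v = one -> mult v u = one -> abs u = 1 -> abs v = 1 ->
  is_linear xs -> is_linear T ->
  norm (mult (xs (T (scal u x))) v : scalars K) = norm (xs (T x)).
Proof.
  intros huv hvu hu hv hl hT. rewrite (linear_scal T hT), (linear_scal xs hl).
  exact (abs_unit_conj u v (xs (T x)) huv hvu hu hv).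
Qed.

Lemma smooth_pairs (hs : uniformly_smooth X) (k : R) : 0 < k ->
  exists t, 0 < t /\ forall x y, norm x = 1 -> norm y = t ->
    norm (plus x y) + norm (minus x y) <= 2 + 2 * k * t.
Proof.
  intros hk. unfold uniformly_smooth in hs.
  destruct (proj1 (filterlim_locally _ _) hs (mkposreal k hk)) as [d hd].
  exists (d / 2). assert (hd0 := cond_pos d). split; [lra |].
  intros x y hx hy.
  assert (b := hd (d / 2)).
  assert (hball : ball 0 d (d / 2)).
  { change (Rabs (d / 2 - 0) < d). rewrite Rabs_pos_eq; lra. }
  specialize (b hball ltac:(lra)).
  change (Rabs (smoothness_modulus X (d / 2) / (d / 2) - 0) < k) in b.
  apply Rabs_def2 in b. destruct b as [b _].
  assert (b' : smoothness_modulus X (d / 2) <= k * (d / 2)).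
  { replace (smoothness_modulus X (d / 2))
      with (smoothness_modulus X (d / 2) / (d / 2) * (d / 2)) by (field; lra).
    apply Rmult_le_compat_r; lra. }
  assert (hle : (norm (plus x y) + norm (minus x y)) / 2 - 1
                <= smoothness_modulus X (d / 2)).
  { unfold smoothness_modulus. apply le_real_Lub with (d / 2).
    - intros s (a & c & ha & hc & ->).
      assert (h1 := norm_triangle a c). assert (h2 := norm_minus_le a c). lra.
    - exists x, y. auto. }
  lra.
Qed.

(** In a uniformly smooth space the norming functional depends on the point in a
    uniformly continuous way.  For [|z| = t], adding
    [Re x*(x + z) <= |x + z|] and [Re y*(x - z) <= |x - z|] gives
    [1 + Re y*(x) + Re (x* - y* )(z) <= 2 + 2 k t]; as [Re y*(x) >= 1 - |y - x|],
    the functional [x* - y*] is small on the sphere of radius [t]. *)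
Lemma duality_map_uniformly_continuous (hs : uniformly_smooth X) (d : R) :
  0 < d -> exists s, 0 < s /\ forall x xs y ys,
    states x xs -> states y ys -> norm (minus x y) <= s ->
    forall z, norm (minus (xs z) (ys z)) <= d * norm z.
Proof.
  intros hd. destruct (smooth_pairs hs (d / 3)) as (t & ht & hsm); [lra |].
  exists (d / 3 * t). split; [nra |].
  intros x xs y ys hx hy hxy.
  apply states_iff in hx. destruct hx as (nx & lx & bx & ex).
  apply states_iff in hy. destruct hy as (ny & ly & by_ & ey).
  assert (hre : forall z, norm z = t -> re (minus (xs z) (ys z) : K) <= d * t).
  { intros z hz. specialize (hsm x z nx hz).
    assert (h1 : 1 + re (xs z : K) <= norm (plus x z)).
    { rewrite <- re_one, <- re_plus.
      eapply Rle_trans; [| apply bx]. rewrite (linear_plus xs lx), ex.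
      apply re_le_abs. }
    assert (h2 : re (ys x : K) - re (ys z : K) <= norm (minus x z)).
    { rewrite <- re_minus.
      eapply Rle_trans; [| apply by_]. rewrite (linear_minus ys _ _ ly).
      apply re_le_abs. }
    assert (h3 : 1 - re (ys x : K) <= norm (minus y x)).
    { rewrite <- re_one, <- re_minus.
      eapply Rle_trans; [| apply by_]. rewrite (linear_minus ys _ _ ly), ey.
      apply re_le_abs. }
    rewrite norm_minus_sym in h3.
    assert (e := re_minus (xs z : K) (ys z)).
    change (re (minus (xs z : K) (ys z : K)) <= d * t). lra. }
  intros z. destruct (Rle_lt_or_eq_dec 0 (norm z) (norm_ge_0 z)) as [h | h].
  - destruct (phase (minus (xs z) (ys z) : K)) as (u & v & huv & hvu & hu & hv & hp).
    assert (hr : 0 < t / norm z) by (apply Rdiv_lt_0_compat; assumption).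
    (* Rescale [z] to norm [t] and rotate it so that the value is real. *)
    set (w := scal (of_R (t / norm z)) (scal u z)).
    assert (hw : norm w = t).
    { unfold w. rewrite norm_scal_of_R, (norm_scal_unit u v) by assumption.
      field. lra. }
    assert (e : minus (xs w) (ys w) =
                mult (of_R (t / norm z)) (mult u (minus (xs z) (ys z) : K))).
    { unfold w. rewrite !(linear_scal xs lx), !(linear_scal ys ly).
      transitivity (scal (of_R (t / norm z)) (minus (scal u (xs z)) (scal u (ys z)))).
      - symmetry. exact (scal_minus_distr_l _ _ _).
      - exact (f_equal (scal (of_R (t / norm z))) (eq_sym (scal_minus_distr_l u (xs z) (ys z)))). }
    specialize (hre w hw). rewrite e, hp, <- of_R_mult, re_of_R in hre.
    change (norm (minus (xs z) (ys z))) with (abs (minus (xs z) (ys z) : K)).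
    apply Rmult_le_reg_l with (t / norm z); [exact hr |].
    eapply Rle_trans; [exact hre |]. right. field. lra.
  - assert (h1 := bx z). assert (h2 := by_ z).
    eapply Rle_trans; [apply norm_minus_le |].
    rewrite <- h in *. lra.
Qed.

(** If [x*(y)] is nearly [1] then [|x + y| >= Re x*(x + y)] is nearly [2], so
    uniform convexity brings [y] near [x]; the functionals follow by
    [duality_map_uniformly_continuous]. *)
Lemma states_close (hc : uniformly_convex X) (hs : uniformly_smooth X) (d : R) :
  0 < d -> exists a, 0 < a /\ forall x xs y ys,
    states x xs -> states y ys -> 1 - a <= re (xs y : K) ->
    norm (minus x y) <= d /\
    forall z, norm (minus (xs z) (ys z)) <= d * norm z.
Proof.
  intros hd. destruct (duality_map_uniformly_continuous hs d hd) as (s & hs0 & hsm).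
  destruct (hc (Rmin d s) (Rmin_pos _ _ hd hs0)) as (a & ha & hconv).
  exists a. split; [exact ha |]. intros x xs y ys hx hy hre.
  assert (hxy : norm (minus x y) < Rmin d s).
  { apply Rnot_le_lt. intros hge.
    destruct (proj1 (states_iff _ _) hx) as (nx & lx & bx & ex).
    destruct hy as (ny & _).
    specialize (hconv x y nx ny hge).
    assert (h1 : 1 + re (xs y : K) <= norm (plus x y)).
    { rewrite <- re_one, <- re_plus.
      eapply Rle_trans; [| apply bx]. rewrite (linear_plus xs lx), ex.
      apply re_le_abs. }
    lra. }
  assert (m1 := Rmin_l d s). assert (m2 := Rmin_r d s).
  split; [lra |]. apply (hsm x xs y ys hx hy). lra.
Qed.
End States.

(** * The rank-one perturbation *)

Section Perturbation.
Context {K : AbsRing} {F : RealOrComplex K} {X : NormedModule K}.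
Implicit Types (T : X -> X) (x y z : X) (xs ys zs : X -> scalars K).

(** The condition [v(T) <= |x*(T x)| + h] without the supremum; for [h = 0] it
    says that the numerical radius is attained at the state. *)
Definition nearly_attains T x xs (h : R) : Prop :=
  is_linear T /\ states x xs /\
  forall z zs, states z zs -> norm (zs (T z)) <= norm (xs (T x)) + h.

Lemma states_bound T (M : R) x xs :
  (forall z, norm (T z) <= M * norm z) -> states x xs -> norm (xs (T x)) <= M.
Proof.
  intros hM hx. apply states_iff in hx. destruct hx as (nx & _ & bx & _).
  eapply Rle_trans; [apply bx |]. specialize (hM x). rewrite nx in hM. lra.
Qed.

Lemma nearly_attains_exists T x xs (h : R) :
  is_linear T -> states x xs -> 0 < h -> exists y ys, nearly_attains T y ys h.
Proof.
  intros hT hx hh. destruct (linear_norm T hT) as (M & _ & hM).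
  destruct (real_Lub_approx
    (fun r => exists (y : X) ys, states y ys /\ r = norm (ys (T y)))
    M (norm (xs (T x))) h) as (s & (y & ys & hy & ->) & hs).
  - intros s (y & ys & hy & ->). now apply states_bound.
  - now exists x, xs.
  - exact hh.
  - exists y, ys. split; [exact hT |]. split; [exact hy |].
    intros z zs hz. apply hs. now exists z, zs.
Qed.

Lemma num_radius_upper T x xs :
  is_linear T -> states x xs -> norm (xs (T x)) <= num_radius T.
Proof.
  intros hT hx. destruct (linear_norm T hT) as (M & _ & hM).
  unfold num_radius. apply le_real_Lub with M.
  - intros s (y & ys & hy & ->). now apply states_bound.
  - now exists x, xs.
Qed.

Lemma num_radius_attained T x xs :
  nearly_attains T x xs 0 -> num_radius T = norm (xs (T x)).
Proof.
  intros (hT & hx & hmax). apply Rle_antisym.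
  - unfold num_radius. apply real_Lub_le with (norm (xs (T x))).
    + intros s (y & ys & hy & ->). specialize (hmax y ys hy). lra.
    + now exists x, xs.
  - now apply num_radius_upper.
Qed.

(** One step of the construction.  The threshold [b] for the errors is uniform
    over all operators and states. *)
Lemma rank_one_step (hc : uniformly_convex X) (hs : uniformly_smooth X) (r : R) :
  0 < r -> exists b, 0 < b /\ forall T x xs h h',
    0 < h' -> h + h' <= b -> nearly_attains T x xs h ->
    exists T' y ys, nearly_attains T' y ys h' /\
      (forall z, norm (minus (T' z) (T z)) <= r * norm z) /\
      norm (minus y x) <= r /\
      (forall z, norm (minus (ys z) (xs z)) <= r * norm z).
Proof.
  intros hr. destruct (states_close hc hs r hr) as (a & ha & hclose).
  exists (r * a). split; [nra |]. intros T x xs h h' hh' hsum (hT & hx & hmax).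
  destruct (proj1 (states_iff _ _) hx) as (nx & lx & bx & ex).
  destruct (aligned_scalar (xs (T x) : K) r (Rlt_le _ _ hr)) as (c & hcr & halign).
  set (T' := fun z => plus (T z) (scal (mult (xs z) c) x)).
  assert (lT' : is_linear T').
  { apply is_linear_add; [exact hT |].
    apply (is_linear_rank_one (fun z => mult (xs z) c : scalars K)).
    now apply is_linear_mult_r. }
  destruct (nearly_attains_exists T' x xs h' lT' hx hh') as (y & ys & _ & hy & hmax').
  destruct (proj1 (states_iff _ _) hy) as (ny & ly & by_ & ey).
  destruct (phase (xs y : K)) as (u & v & huv & hvu & hu & hv & hp).
  assert (hrank : forall z, norm (mult (xs z) c : scalars K) <= norm (xs z) * r).
  { intros z. eapply Rle_trans; [exact (abs_mult (xs z) c) |].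
    apply Rmult_le_compat_l; [apply (abs_ge_0 (xs z : K)) | exact hcr]. }
  assert (hx' : norm (xs (T' x)) = norm (xs (T x)) + r).
  { transitivity (abs (plus (xs (T x)) c : K)); [| exact halign].
    unfold T'. rewrite (linear_plus xs lx), (linear_scal xs lx), ex.
    change (abs (plus (xs (T x)) (mult (mult one c) one) : K)
            = abs (plus (xs (T x)) c)).
    now rewrite mult_one_l, mult_one_r. }
  assert (hy' : norm (ys (T' y)) <= norm (ys (T y)) + norm (xs y) * r).
  { unfold T'. rewrite (linear_plus ys ly), (linear_scal ys ly).
    eapply Rle_trans; [apply norm_triangle |]. apply Rplus_le_compat_l.
    eapply Rle_trans; [exact (abs_mult (mult (xs y) c : K) (ys x)) |].
    assert (h1 := by_ x). rewrite nx in h1.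
    change (norm (mult (xs y) c : scalars K) * norm (ys x) <= norm (xs y) * r).
    specialize (hrank y).
    assert (h2 := norm_ge_0 (mult (xs y) c : scalars K)).
    assert (h3 := norm_ge_0 (ys x)). nra. }
  (* Near-maximality of [x] for [T] and of [y] for [T'] are played against
     each other; here [|y*(x)| <= 1] has already been absorbed in [hy']. *)
  assert (hxy : 1 - a <= norm (xs y)).
  { assert (h1 := hmax' x xs hx). assert (h2 := hmax y ys hy).
    apply Rmult_le_reg_l with r; [exact hr |]. lra. }
  assert (hrot := states_rotate y ys u v huv hvu hu hv hy).
  destruct (hclose x xs (scal u y) (fun z => mult (ys z) v) hx hrot) as [c1 c2].
  { rewrite (linear_scal xs lx).
    change (1 - a <= re (mult u (xs y : K))). rewrite hp, re_of_R. exact hxy. }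
  exists T', (scal u y), (fun z => mult (ys z) v).
  split; [| split; [| split]].
  - split; [exact lT' |]. split; [exact hrot |]. intros z zs hz.
    rewrite (abs_rotate y ys T' u v huv hvu hu hv ly lT'). now apply hmax'.
  - intros z. unfold T'.
    replace (minus (plus (T z) (scal (mult (xs z) c) x)) (T z))
      with (scal (mult (xs z) c) x).
    + eapply Rle_trans; [apply norm_scal |]. rewrite nx, Rmult_1_r.
      eapply Rle_trans; [exact (hrank z) |]. specialize (bx z). nra.
    + rewrite plus_comm. unfold minus. rewrite <- plus_assoc.
      rewrite <- (plus_zero_r (scal _ _)) at 1. f_equal.
      symmetry. exact (plus_opp_r (T z)).
  - rewrite norm_minus_sym. exact c1.
  - intros z. rewrite norm_minus_sym. apply c2.
Qed.
End Perturbation.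

(** * Sequences and limits at a geometric rate *)

Lemma indexed_dependent_choice {A : Type} (P : nat -> A -> Prop)
    (Q : nat -> A -> A -> Prop) (a : A) :
  P 0%nat a ->
  (forall n b, P n b -> exists c, P (S n) c /\ Q n b c) ->
  exists f : nat -> A, f 0%nat = a /\ forall n, P n (f n) /\ Q n (f n) (f (S n)).
Proof.
  intros ha hstep.
  destruct (functional_choice (fun (p : nat * A) (c : A) =>
    P (fst p) (snd p) -> P (S (fst p)) c /\ Q (fst p) (snd p) c)) as [g hg].
  { intros [n b]. destruct (classic (P n b)) as [h | h].
    - destruct (hstep n b h) as [c hc]. now exists c.
    - exists b. intros h'. contradiction. }
  pose (f := fix f n := match n with O => a | S m => g (m, f m) end).
  assert (hP : forall n, P n (f n)).
  { induction n as [| n IH]; [exact ha | exact (proj1 (hg (n, f n) IH))]. }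
  exists f. split; [reflexivity |]. intros n.
  split; [apply hP | exact (proj2 (hg (n, f n) (hP n)))].
Qed.

Lemma le_of_geometric (a b c : R) : (forall n, a <= b + c / 2 ^ n) -> a <= b.
Proof.
  intros h. apply Rnot_lt_le. intros hlt.
  assert (h0 := h O). simpl in h0.
  assert (hc : 0 < c) by lra.
  destruct (pow_lt_1_zero (/ 2) ltac:(rewrite Rabs_pos_eq; lra) ((a - b) / c))
    as [n hn]; [apply Rdiv_lt_0_compat; lra |].
  specialize (hn n (le_n n)). specialize (h n).
  rewrite Rabs_pos_eq in hn by (apply pow_le; lra).
  rewrite pow_inv in hn. apply Rmult_lt_compat_l with (r := c) in hn; [| lra].
  replace (c * ((a - b) / c)) with (a - b) in hn by (field; lra).
  unfold Rdiv in h. lra.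
Qed.

Lemma eq_of_geometric {K : AbsRing} {V : NormedModule K} (x y : V) (c : R) :
  (forall n, norm (minus x y) <= c / 2 ^ n) -> x = y.
Proof.
  intros h. apply (minus_zero_eq (G := V)), norm_eq_zero.
  apply Rle_antisym; [| apply norm_ge_0].
  apply le_of_geometric with c. intros n. rewrite Rplus_0_l. apply h.
Qed.

Section Limits.
Context {K : AbsRing} {X : CompleteNormedModule K}.
Local Notation V := (CompleteNormedModule.NormedModule K X).

Lemma geometric_limit (u : nat -> V) (r : R) :
  0 <= r -> (forall n, norm (minus (u (S n)) (u n)) <= r / 2 ^ n) ->
  exists l : V, forall n, norm (minus l (u n)) <= 2 * r / 2 ^ n.
Proof.
  intros hr hu.
  (* The subtracted tail makes the telescoping estimate close by induction. *)
  assert (hgap : forall n k, norm (minus (u (n + k)%nat) (u n))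
                             <= 2 * r / 2 ^ n - 2 * r / 2 ^ (n + k)).
  { intros n k. induction k as [| k IH].
    - rewrite Nat.add_0_r, (norm_minus_self (V := V)). lra.
    - rewrite Nat.add_succ_r.
      eapply Rle_trans; [apply (norm_minus_triangle _ (u (n + k)%nat)) |].
      specialize (hu (n + k)%nat).
      assert (hp : 0 < 2 ^ (n + k)) by (apply pow_lt; lra).
      replace (2 * r / 2 ^ S (n + k)) with (2 * r / 2 ^ (n + k) - r / 2 ^ (n + k))
        by (simpl; field; lra).
      lra. }
  assert (hpos : forall n, 0 <= 2 * r / 2 ^ n).
  { intros n. apply Rmult_le_pos; [lra |].
    apply Rlt_le, Rinv_0_lt_compat, pow_lt. lra. }
  assert (hfar : forall n m, (n <= m)%nat -> norm (minus (u m) (u n)) <= 2 * r / 2 ^ n).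
  { intros n m hnm. replace m with (n + (m - n))%nat by lia.
    eapply Rle_trans; [apply hgap |]. specialize (hpos (n + (m - n))%nat). lra. }
  destruct (proj1 (filterlim_locally_cauchy (U := X) (F := eventually) u)) as [l hl].
  { intros e.
    assert (hsmall : exists n, 2 * r / 2 ^ n < e / 2).
    { apply NNPP. intros hn. assert (e / 2 <= 0).
      { apply le_of_geometric with (2 * r). intros n.
        rewrite Rplus_0_l. apply Rnot_lt_le. intros h. apply hn. now exists n. }
      assert (h := cond_pos e). lra. }
    destruct hsmall as [n hn]. exists (fun m => (n <= m)%nat). split.
    - now exists n.
    - intros p q hp hq. apply (norm_compat1 (V := V)).
      eapply Rle_lt_trans; [apply (norm_minus_triangle _ (u n)) |].
      assert (h1 := hfar n q hq). assert (h2 := hfar n p hp).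
      rewrite (norm_minus_sym (u n)). lra. }
  exists l. intros n. apply le_epsilon. intros e he.
  assert (he' : 0 < e / norm_factor (V := V))
    by (apply Rdiv_lt_0_compat; [exact he | apply norm_factor_gt_0]).
  destruct (proj1 (filterlim_locally _ _) hl (mkposreal _ he')) as [N hN].
  specialize (hN (max N n) (Nat.le_max_l N n)).
  apply (norm_compat2 (V := V)) in hN. simpl in hN.
  replace (norm_factor (V := V) * (e / norm_factor (V := V))) with e in hN
    by (field; apply Rgt_not_eq, norm_factor_gt_0).
  assert (h := hfar n (max N n) (Nat.le_max_r N n)).
  eapply Rle_trans; [apply (norm_minus_triangle _ (u (max N n))) |].
  rewrite norm_minus_sym. lra.
Qed.

(** Linearity passes to the limit because both sides of each identity are within
    a multiple of [1 / 2^n] of each other for every [n]. *)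
Lemma geometric_limit_linear {U : NormedModule K} (A : nat -> U -> V) (r : R) :
  0 <= r -> (forall n, is_linear (A n)) ->
  (forall n z, norm (minus (A (S n) z) (A n z)) <= r / 2 ^ n * norm z) ->
  exists L : U -> V, is_linear L /\
    forall n z, norm (minus (L z) (A n z)) <= 2 * r / 2 ^ n * norm z.
Proof.
  intros hr hA hstep.
  destruct (functional_choice (fun (z : U) (l : V) => forall n,
    norm (minus l (A n z)) <= 2 * r / 2 ^ n * norm z)) as [L hL].
  { intros z. destruct (geometric_limit (fun n => A n z) (r * norm z)) as [l hl].
    - apply Rmult_le_pos; [exact hr | apply norm_ge_0].
    - intros n. eapply Rle_trans; [apply hstep |]. right. unfold Rdiv. ring.
    - exists l. intros n. eapply Rle_trans; [apply hl |]. right. unfold Rdiv. ring. }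
  exists L. split; [| exact (fun n z => hL z n)]. constructor.
  - intros x y. apply eq_of_geometric
      with (2 * r * norm (plus x y) + 2 * r * norm x + 2 * r * norm y).
    intros n.
    eapply Rle_trans; [apply (norm_minus_triangle _ (A n (plus x y))) |].
    rewrite (linear_plus (A n) (hA n)) at 2.
    assert (h1 := hL (plus x y) n). assert (h2 := hL x n). assert (h3 := hL y n).
    rewrite norm_minus_sym in h2, h3.
    assert (h4 := norm_minus_plus (A n x) (A n y) (L x) (L y)).
    unfold Rdiv in *. lra.
  - intros k x. apply eq_of_geometric
      with (2 * r * norm (scal k x) + abs k * (2 * r * norm x)).
    intros n.
    eapply Rle_trans; [apply (norm_minus_triangle _ (A n (scal k x))) |].
    assert (h1 := hL (scal k x) n). assert (h2 := hL x n).
    rewrite norm_minus_sym in h2.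
    assert (h3 : norm (minus (A n (scal k x)) (scal k (L x)))
                 <= abs k * norm (minus (A n x) (L x))).
    { rewrite (linear_scal (A n) (hA n)).
      eapply Rle_trans; [| apply norm_scal].
      right. apply (f_equal norm). symmetry.
      exact (scal_minus_distr_l k (A n x) (L x)). }
    assert (h4 := Rmult_le_compat_l _ _ _ (abs_ge_0 k) h2).
    unfold Rdiv in *. lra.
  - destruct (linear_norm (A O) (hA O)) as (M & hM & hb).
    exists (2 * r + M). split; [lra |]. intros x.
    assert (h1 := hL x O). rewrite pow_O, Rdiv_1_r in h1. specialize (hb x).
    assert (h2 := norm_le_minus_plus (L x) (A O x)). lra.
Qed.
End Limits.

(** Scalars are embedded in [X] as multiples of [x0] and recovered by [x0s], so
    completeness of [X] yields limits of functionals. *)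
Lemma geometric_limit_functional {K : AbsRing} {F : RealOrComplex K}
    {X : CompleteNormedModule K} (U : NormedModule K)
    (x0 : CompleteNormedModule.NormedModule K X)
    (x0s : CompleteNormedModule.NormedModule K X -> scalars K)
    (f : nat -> U -> scalars K) (r : R) :
  states x0 x0s -> 0 <= r -> (forall n, is_linear (f n)) ->
  (forall n z, norm (minus (f (S n) z) (f n z)) <= r / 2 ^ n * norm z) ->
  exists L : U -> scalars K, is_linear L /\
    forall n z, norm (minus (L z) (f n z)) <= 2 * r / 2 ^ n * norm z.
Proof.
  intros h0 hr hf hstep.
  apply states_iff in h0. destruct h0 as (nx & lx & bx & ex).
  destruct (geometric_limit_linear (fun n z => scal (f n z) x0) r hr)
    as (G & hG & hlim).
  - intros n. now apply is_linear_rank_one.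
  - intros n z.
    apply Rle_trans with (norm (scal (minus (f (S n) z) (f n z) : K) x0)).
    + right. apply (f_equal norm). symmetry.
      exact (scal_minus_distr_r (f (S n) z : K) (f n z) x0).
    + eapply Rle_trans; [apply norm_scal |]. rewrite nx, Rmult_1_r. apply hstep.
  - exists (fun z => x0s (G z)). split; [now apply is_linear_comp |].
    intros n z.
    replace (f n z) with (x0s (scal (f n z) x0)).
    + rewrite <- (linear_minus x0s _ _ lx).
      eapply Rle_trans; [apply bx | apply hlim].
    + rewrite (linear_scal x0s lx), ex. exact (mult_one_r (f n z : K)).
Qed.

(** * Passage to the limit *)

Section LimitOfStates.
Context {K : AbsRing} {F : RealOrComplex K} {X : NormedModule K}.
Context (x : nat -> X) (xs : nat -> X -> scalars K) (y : X) (ys : X -> scalars K).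
Context (c : R).
Context (hx : forall n, states (x n) (xs n)).
Context (hy : forall n, norm (minus y (x n)) <= c / 2 ^ n).
Context (hys : forall n z, norm (minus (ys z) (xs n z)) <= c / 2 ^ n * norm z).
Context (lys : is_linear ys).

Lemma limit_states : states y ys.
Proof.
  apply states_iff.
  assert (ny : norm y = 1).
  { apply Rle_antisym.
    - apply le_of_geometric with c. intros n.
      assert (h := norm_le_minus_plus y (x n)).
      rewrite (proj1 (hx n)) in h. specialize (hy n). lra.
    - apply le_of_geometric with c. intros n.
      assert (h := norm_le_minus_plus (x n) y).
      rewrite (proj1 (hx n)), norm_minus_sym in h. specialize (hy n). lra. }
  split; [exact ny |]. split; [exact lys |]. split.
  - intros z. apply le_of_geometric with (c * norm z). intros n.
    destruct (proj1 (states_iff _ _) (hx n)) as (_ & _ & bx & _).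
    assert (h := norm_le_minus_plus (ys z) (xs n z)).
    specialize (bx z). specialize (hys n z). unfold Rdiv in *. lra.
  - apply eq_of_geometric with (c + c). intros n.
    destruct (proj1 (states_iff _ _) (hx n)) as (_ & lx & bx & ex).
    eapply Rle_trans; [apply (norm_minus_triangle _ (xs n y)) |].
    rewrite <- ex, <- (linear_minus (xs n) _ _ lx).
    specialize (bx (minus y (x n))).
    assert (h1 := hy n). assert (h2 := hys n y). rewrite ny in h2.
    unfold Rdiv in *. lra.
Qed.

(** For any state [(z, z* )], the value [|z*(S z)|] is at most [|z*(T_n z)|], hence
    [|x_n*(T_n x_n)| + h_n], hence [|y*(S y)|], up to errors of order [1 / 2^n].
    The last comparison goes through [x_n*(S x_n)] and [y*(S x_n)], so that only
    the bound of [S] enters, not those of the [T_n]. *)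
Lemma limit_nearly_attains (T : nat -> X -> X) (S : X -> X) (h : nat -> R) :
  is_linear S ->
  (forall n z, norm (minus (S z) (T n z)) <= c / 2 ^ n * norm z) ->
  (forall n, nearly_attains (T n) (x n) (xs n) (h n)) ->
  (forall n, h n <= 1 / 2 ^ n) ->
  nearly_attains S y ys 0.
Proof.
  intros lS hS hT hh. split; [exact lS |]. split; [exact limit_states |].
  intros z zs hz. rewrite Rplus_0_r.
  destruct (linear_norm S lS) as (M & hM & bS).
  destruct (proj1 (states_iff _ _) hz) as (nz & lz & bz & _).
  destruct (proj1 (states_iff _ _) limit_states) as (ny & _ & by_ & _).
  apply le_of_geometric with (c + 1 + c + c * M + M * c). intros n.
  destruct (proj1 (states_iff _ _) (hx n)) as (nx & lx & bx & _).
  destruct (hT n) as (_ & _ & hmax). specialize (hmax z zs hz).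
  assert (h1 := norm_le_minus_plus (zs (S z)) (zs (T n z))).
  rewrite <- (linear_minus zs _ _ lz) in h1.
  assert (h2 := bz (minus (S z) (T n z))).
  assert (h3 := hS n z). rewrite nz in h3.
  assert (h4 := norm_le_minus_plus (xs n (T n (x n))) (xs n (S (x n)))).
  rewrite <- (linear_minus (xs n) _ _ lx) in h4.
  assert (h5 := bx (minus (T n (x n)) (S (x n)))).
  rewrite (norm_minus_sym (T n (x n))) in h5.
  assert (h6 := hS n (x n)). rewrite nx in h6.
  assert (h7 := norm_le_minus_plus (xs n (S (x n))) (ys (S (x n)))).
  rewrite norm_minus_sym in h7.
  assert (h8 := hys n (S (x n))).
  assert (h9 := bS (x n)). rewrite nx in h9.
  assert (h10 := norm_le_minus_plus (ys (S (x n))) (ys (S y))).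
  rewrite <- (linear_minus ys _ _ lys), <- (linear_minus S _ _ lS) in h10.
  assert (h11 := by_ (S (minus (x n) y))).
  assert (h12 := bS (minus (x n) y)).
  rewrite (norm_minus_sym (x n)) in h12.
  assert (h13 := Rmult_le_compat_l M _ _ (Rlt_le _ _ hM) (hy n)).
  assert (hc : 0 <= c / 2 ^ n) by
    exact (Rle_trans _ _ _ (norm_ge_0 (minus y (x n))) (hy n)).
  assert (h14 := Rmult_le_compat_l _ _ _ hc h9).
  specialize (hh n). unfold Rdiv in *. lra.
Qed.
End LimitOfStates.

(** The iteration.  Step [n] uses the errors [h n] and [h (n + 1)], so [h n] must be
    below half the thresholds of both step [n] and step [n - 1]. *)
Lemma proximal_attaining_operator {K : AbsRing} {F : RealOrComplex K}
    (X : CompleteNormedModule K)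
    (hc : uniformly_convex X) (hs : uniformly_smooth X) (e : R) :
  0 < e -> exists eta, 0 < eta /\
    forall (T0 : X -> X) (x0 : X) (x0s : X -> scalars K),
      nearly_attains T0 x0 x0s eta ->
      exists (S : X -> X) (y : X) (ys : X -> scalars K),
        nearly_attains S y ys 0 /\ norm (minus y x0) <= e /\
        (forall z, norm (minus (ys z) (x0s z)) <= e * norm z) /\
        (forall z, norm (minus (S z) (T0 z)) <= e * norm z).
Proof.
  intros he. set (r := e / 2).
  assert (hp : forall n, 0 < 2 ^ n) by (intros n; apply pow_lt; lra).
  assert (hrn : forall n, 0 < r / 2 ^ n)
    by (intros n; apply Rdiv_lt_0_compat; [unfold r; lra | apply hp]).
  destruct (functional_choice _ (fun n => rank_one_step hc hs (r / 2 ^ n) (hrn n)))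
    as [b hb].
  set (h := fun n => Rmin (Rmin (b n) (b (pred n))) (1 / 2 ^ n) / 2).
  assert (hh : forall n, 0 < h n /\ h n <= b n / 2 /\ h n <= b (pred n) / 2 /\
                         h n <= 1 / 2 ^ n).
  { intros n. unfold h.
    assert (h0 : 0 < 1 / 2 ^ n) by (apply Rdiv_lt_0_compat; [lra | apply hp]).
    assert (h1 := Rmin_pos _ _ (Rmin_pos _ _ (proj1 (hb n)) (proj1 (hb (pred n)))) h0).
    assert (h2 := Rmin_l (Rmin (b n) (b (pred n))) (1 / 2 ^ n)).
    assert (h3 := Rmin_r (Rmin (b n) (b (pred n))) (1 / 2 ^ n)).
    assert (h4 := Rmin_l (b n) (b (pred n))).
    assert (h5 := Rmin_r (b n) (b (pred n))). lra. }
  exists (h O). split; [apply hh |]. intros T0 x0 x0s h0.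
  destruct (indexed_dependent_choice
    (fun n (p : (X -> X) * X * (X -> scalars K)) =>
       nearly_attains (fst (fst p)) (snd (fst p)) (snd p) (h n))
    (fun n p q =>
       (forall z, norm (minus (fst (fst q) z) (fst (fst p) z)) <= r / 2 ^ n * norm z) /\
       norm (minus (snd (fst q)) (snd (fst p))) <= r / 2 ^ n /\
       (forall z, norm (minus (snd q z) (snd p z)) <= r / 2 ^ n * norm z))
    (T0, x0, x0s) h0) as (f & f0 & hf).
  { intros n [[T x] xs] hn.
    destruct (proj2 (hb n) T x xs (h n) (h (S n))) as (T' & y & ys & hT' & hQ).
    - apply hh.
    - assert (h1 := hh n). assert (h2 := hh (S n)). simpl pred in h2. lra.
    - exact hn.
    - exists (T', y, ys). split; [exact hT' | exact hQ]. }
  set (T := fun n => fst (fst (f n))). set (x := fun n => snd (fst (f n))).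
  set (xs := fun n => snd (f n)).
  assert (hT : forall n, nearly_attains (T n) (x n) (xs n) (h n)) by (intros n; apply hf).
  assert (hr : 0 <= r) by (unfold r; lra).
  destruct (geometric_limit x r hr) as [y hy]; [intros n; apply hf |].
  destruct (geometric_limit_linear T r hr) as (S & lS & hS);
    [intros n; apply hT | intros n; apply hf |].
  destruct (geometric_limit_functional _ x0 x0s xs r (proj1 (proj2 h0)) hr)
    as (ys & lys & hys);
    [intros n; apply (proj1 (proj2 (hT n))) | intros n; apply hf |].
  exists S, y, ys. split.
  - apply (limit_nearly_attains x xs y ys (2 * r)) with (T := T) (h := h); try assumption.
    + intros n; apply hT.
    + intros n; apply hh.
  - specialize (hy O). assert (hS0 := hS O). assert (hys0 := hys O).
    unfold T, x, xs in hy, hS0, hys0. rewrite f0 in hy, hS0, hys0.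
    simpl fst in *. simpl snd in *.
    assert (er : 2 * r / 2 ^ 0 = e) by (unfold r; simpl; field).
    rewrite er in *. auto.
Qed.

Theorem proposition3p1 (K : AbsRing) (hK : K = R_AbsRing \/ K = C_AbsRing)
    (X : CompleteNormedModule K)
    (hconv : uniformly_convex X) (hsmooth : uniformly_smooth X)
    (eps : R) (heps : 0 < eps) :
  exists eta : R, 0 < eta /\
    forall (T0 : X -> X) (x0 : X) (x0s : X -> scalars K),
      is_linear T0 -> num_radius T0 = 1 -> states x0 x0s ->
      norm (x0s (T0 x0)) > 1 - eta ->
      exists (S : X -> X) (y : X) (ys : X -> scalars K),
        is_linear S /\ states y ys /\
        num_radius S = norm (ys (S y)) /\
        norm (minus x0 y) < eps /\
        op_norm (fun x => minus (x0s x) (ys x)) < eps /\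
        op_norm (fun x => minus (S x) (T0 x)) < eps.
Proof.
  assert (hF : inhabited (RealOrComplex K))
    by (destruct hK as [-> | ->]; constructor; [exact R_scalars | exact C_scalars]).
  destruct hF as [F].
  destruct (proximal_attaining_operator X hconv hsmooth (eps / 2)) as (eta & heta & main);
    [lra |].
  exists eta. split; [exact heta |]. intros T0 x0 x0s hT0 hv hx0 hnear.
  destruct (main T0 x0 x0s) as (S & y & ys & hS & hy & hys & hST).
  { split; [exact hT0 |]. split; [exact hx0 |]. intros z zs hz.
    assert (h := num_radius_upper T0 z zs hT0 hz). rewrite hv in h. lra. }
  exists S, y, ys. split; [apply hS |]. split; [apply hS |].
  split; [now apply num_radius_attained |]. split; [| split].
  - apply Rle_lt_trans with (eps / 2); [| lra].
    eapply Rle_trans; [right; apply (norm_minus_sym (V := X)) | exact hy].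
  - apply Rle_lt_trans with (eps / 2); [| lra]. apply op_norm_le; [lra |].
    intros z. rewrite norm_minus_sym. apply hys.
  - apply Rle_lt_trans with (eps / 2); [| lra]. apply op_norm_le; [lra |]. exact hST.
Qed.
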